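(* Let $P=\mathcal{N}(\mu_P,\Sigma_P)$ and $Q=\mathcal{N}(\mu_Q,\Sigma_Q)$ be Gaussian distributions on $\mathbb{R}^d$ with positive definite covariance matrices $\Sigma_P,\Sigma_Q$. Then: (1) $D$ is symmetric, meaning $D(P,Q)=D(Q,P)$; (2) $D(P,Q)=0$ if and only if $P=Q$ (in particular $D(P,P)=0$).
   Context: For Gaussians $P=\mathcal{N}(\mu_P,\Sigma_P)$ and $Q=\mathcal{N}(\mu_Q,\Sigma_Q)$ on $\mathbb{R}^d$ with positive definite covariances, define \[ D(P,Q)=\tfrac12\left\|\Sigma_Q^{-1/2}\Sigma_P\Sigma_Q^{-1/2}-I\right\|_F+\tfrac12\left\|\Sigma_P^{-1/2}\Sigma_Q\Sigma_P^{-1/2}-I\right\|_F+\tfrac{1}{\sqrt2}\|\mu_P-\mu_Q\|_{\Sigma_Q^{-1}}+\tfrac{1}{\sqrt2}\|\mu_P-\mu_Q\|_{\Sigma_P^{-1}}. \] Here $\|\cdot\|_F$ is the Frobenius norm, $\|x\|_A:=\sqrt{x^TAx}$ for positive definite $A$, and $A^{-1/2}$ is the inverse of the positive definite square root of $A$. *)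

(* Defs.v *)
From HB Require Import structures.
From mathcomp Require Import all_boot all_order all_algebra.
From mathcomp Require Import all_classical all_reals all_analysis giry.

Set Implicit Arguments.
Unset Strict Implicit.
Unset Printing Implicit Defensive.

Import Order.TTheory GRing.Theory Num.Theory.
Import numFieldNormedType.Exports.

Local Open Scope classical_set_scope.
Local Open Scope ring_scope.

Section matrices.
Context {R : realType}.

Definition posdef d (A : 'M[R]_d) : Prop :=
  A^T = A /\ forall x : 'cV[R]_d, x != 0 -> 0 < (x^T *m A *m x) 0 0.

(* The positive definite square root: every positive definite A has exactly one
   positive definite B with B *m B = A, so for such A the default value 0 is
   never returned. *)
Definition sqrtmx d (A : 'M[R]_d) : 'M[R]_d :=
  xget 0 [set B : 'M[R]_d | posdef B /\ B *m B = A].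

Definition invsqrtmx d (A : 'M[R]_d) : 'M[R]_d := invmx (sqrtmx A).

Definition frob_norm d (A : 'M[R]_d) : R :=
  Num.sqrt (\sum_i \sum_j A i j ^+ 2).

Definition quad_norm d (A : 'M[R]_d) (x : 'cV[R]_d) : R :=
  Num.sqrt ((x^T *m A *m x) 0 0).

End matrices.

(* Points of R^d are d-tuples, whose library sigma-algebra is the product of the
   Borel sigma-algebras, that is, the Borel sigma-algebra of R^d. *)
Notation Rvec R d := (d.-tuple (measurableTypeR R)).

Section lebesgue_tuple.
Local Open Scope ereal_scope.
Context {R : realType}.

Definition cons_pair n (p : measurableTypeR R * Rvec R n) : Rvec R n.+1 :=
  [the n.+1.-tuple (measurableTypeR R) of p.1 :: p.2].

Lemma measurable_cons_pair n : measurable_fun [set: _] (@cons_pair n).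
Proof. by apply: (@measurable_cons _ _ _ _ fst n snd). Qed.

Definition lebesgue_cons n (m : set (Rvec R n) -> \bar R) :
    set (Rvec R n.+1) -> \bar R :=
  pushforward (@lebesgue_measure R \x m) (@cons_pair n).

Section instances.
Context n (m : {sigma_finite_measure set (Rvec R n) -> \bar R}).

Let lebesgue_cons0 : lebesgue_cons m set0 = 0.
Proof. by rewrite /lebesgue_cons /pushforward preimage_set0 measure0. Qed.

Let lebesgue_cons_ge0 A : 0 <= lebesgue_cons m A.
Proof. by rewrite /lebesgue_cons /pushforward; exact: measure_ge0. Qed.

Let lebesgue_cons_sigma_additive : semi_sigma_additive (lebesgue_cons m).
Proof.
move=> F mF tF mUF; rewrite /lebesgue_cons /pushforward preimage_bigcup.
have mp A : measurable A -> measurable (@cons_pair n @^-1` A).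
  by move=> mA; rewrite -[X in measurable X]setTI; exact: measurable_cons_pair.
apply: measure_semi_sigma_additive => [i||]; first exact: mp.
- apply/trivIsetP => /= i j _ _ ij; rewrite -preimage_setI.
  by move/trivIsetP : tF => /(_ _ _ _ _ ij) ->//; rewrite preimage_set0.
- by rewrite -preimage_bigcup; exact: mp.
Qed.

HB.instance Definition _ := isMeasure.Build _ _ _ (lebesgue_cons m)
  lebesgue_cons0 lebesgue_cons_ge0 lebesgue_cons_sigma_additive.

Let lebesgue_cons_sigma_finite : sigma_finite setT (lebesgue_cons m).
Proof.
have /sigma_finiteP[F [FT ndF mF]] := sigma_finiteT (@lebesgue_measure R).
have /sigma_finiteP[G [GT ndG mG]] := sigma_finiteT m.
pose hd (x : Rvec R n.+1) : measurableTypeR R := tnth x ord0.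
pose tl (x : Rvec R n.+1) : Rvec R n := [tuple of behead x].
exists (fun i => hd @^-1` F i `&` tl @^-1` G i).
  rewrite predeqE => x; split => // _.
  have [i _ Fi] : (\bigcup_i F i) (hd x) by rewrite -FT.
  have [j _ Gj] : (\bigcup_i G i) (tl x) by rewrite -GT.
  exists (maxn i j) => //; split.
  - by have /subsetPset := ndF _ _ (leq_maxl i j); apply.
  - by have /subsetPset := ndG _ _ (leq_maxr i j); apply.
move=> i; have [mFi Fi] := mF i; have [mGi Gi] := mG i; split.
  apply: measurableI; rewrite -[X in measurable X]setTI.
  - exact: measurable_tnth.
  - exact: measurable_behead.
have tlK p : tl (cons_pair p) = p.2 by exact/val_inj.
rewrite /lebesgue_cons /pushforward (_ : _ @^-1` _ = F i `*` G i).
  by rewrite product_measure1E// lte_mul_pinfty// ge0_fin_numE.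
by apply/seteqP; split => p /=; rewrite tlK.
Qed.

HB.instance Definition _ := Measure_isSigmaFinite.Build _ _ _
  (lebesgue_cons m) lebesgue_cons_sigma_finite.

End instances.

(* d-dimensional Lebesgue measure: the d-fold product of the one-dimensional
   Lebesgue measure, the empty product being the unit mass on the point R^0. *)
Fixpoint lebesgue_tuple d : {sigma_finite_measure set (Rvec R d) -> \bar R} :=
  match d with
  | 0%N => [the {sigma_finite_measure set (Rvec R 0) -> \bar R} of
              dirac [tuple]]
  | n.+1 => [the {sigma_finite_measure set (Rvec R n.+1) -> \bar R} of
              lebesgue_cons (lebesgue_tuple n)]
  end.

End lebesgue_tuple.

Section gaussian.
Context {R : realType}.

Definition gaussian_pdf d (mu : 'cV[R]_d) (S : 'M[R]_d) (x : Rvec R d) : R :=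
  let y := \col_i tnth x i - mu in
  expR (- (1 / 2) * (y^T *m invmx S *m y) 0 0)
  / Num.sqrt ((2 * pi) ^+ d * \det S).

Definition is_gaussian d (mu : 'cV[R]_d) (S : 'M[R]_d)
    (P : probability (Rvec R d) R) : Prop :=
  forall A, measurable A ->
    P A = (\int[lebesgue_tuple d]_(x in A) (gaussian_pdf mu S x)%:E)%E.

Definition gaussianD d (muP : 'cV[R]_d) (SP : 'M[R]_d)
    (muQ : 'cV[R]_d) (SQ : 'M[R]_d) : R :=
  1 / 2 * frob_norm (invsqrtmx SQ *m SP *m invsqrtmx SQ - 1%:M)
  + 1 / 2 * frob_norm (invsqrtmx SP *m SQ *m invsqrtmx SP - 1%:M)
  + 1 / Num.sqrt 2 * quad_norm (invmx SQ) (muP - muQ)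
  + 1 / Num.sqrt 2 * quad_norm (invmx SP) (muP - muQ).

End gaussian.

(* Main.v *)
(* Each of the four terms of D is nonnegative and vanishes exactly when the
   covariances, respectively the means, agree; this requires the positive
   definite square roots to exist. Conversely, if the laws agree, then so do the
   continuous densities, because Lebesgue measure charges every box. The two
   quadratic exponents then differ by a constant, which must be 0 since each
   exponent attains its minimum 0 at its own mean; hence the means are equal, and
   the inverse covariances agree by polarization. *)

Require Import Defs.
From mathcomp Require Import all_boot all_order all_algebra.
From mathcomp Require Import all_classical all_reals all_analysis giry.
From mathcomp Require Import measurable_realfun complex spectral sesquilinear.
From mathcomp Require Import ring lra.

Set Implicit Arguments.
Unset Strict Implicit.
Unset Printing Implicit Defensive.

Import Order.TTheory GRing.Theory Num.Theory.
Import numFieldNormedType.Exports.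

Local Open Scope classical_set_scope.
Local Open Scope ring_scope.

(** * Square roots of positive definite matrices, by interpolation on the spectrum *)

Lemma poly_interpolation (F : fieldType) (s : seq F) (f : F -> F) :
  exists p : {poly F}, {in s, forall x, p.[x] = f x}.
Proof.
elim: s => [|a s [p ps]]; first by exists 0.
have [as_|as_] := boolP (a \in s).
  by exists p => x; rewrite inE => /predU1P[->|]; exact: ps.
(* Newton's correction: [q] vanishes on [s] but not at [a], so a multiple of it fixes the value at
   [a] and leaves the other values alone. *)
pose q := \prod_(b <- s) ('X - b%:P).
have qa : q.[a] != 0 by rewrite -rootE root_prod_XsubC.
exists (p + ((f a - p.[a]) / q.[a]) *: q) => x.
rewrite inE hornerD hornerZ => /predU1P[->|xs]; first by rewrite divfK// subrKC.
have /rootP -> : root q x by rewrite root_prod_XsubC.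
by rewrite mulr0 addr0 ps.
Qed.

Section matrix_sqrt.
Context {R : realType}.

(* The spectral theorem holds over [R[i]]; polynomials in [A] keep the outcome
   real. *)
Lemma sym_spectrum n (A : 'M[R]_n.+1) : A^T = A ->
  exists s : seq R, {subset s <= eigenvalue A} /\
    forall p q : {poly R}, {in s, forall a, p.[a] = q.[a]} ->
      horner_mx A p = horner_mx A q.
Proof.
move=> symA; pose Ac := map_mx (real_complex R) A.
have Ah : Ac \is hermsymmx.
  apply/realsym_hermsym.
    apply/is_hermitianmxP.
    by apply/matrixP => i j; rewrite expr0 scale1r !mxE -{1}symA mxE.
  by apply/mxOverP => i j; rewrite mxE; apply/complex_realP; exists (A i j).
have Dreal := hermitian_spectral_diag_real Ah.
have /hermitian_normalmx/orthomx_spectralP := Ah.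
have Uu := spectral_unit Ac.
move: (spectralmx Ac) (spectral_diag Ac) Uu Dreal => U D Uu Dreal AcE.
pose l i := complex.Re (D 0 i).
have lD i : (l i)%:C%C = D 0 i by rewrite RRe_real//; exact: (mxOverP Dreal).
exists (codom l); split.
  move=> _ /codomP[i ->].
  suff : eigenvalue Ac (l i)%:C%C by rewrite eigenvalue_map.
  (* The rows of the diagonalising matrix [U] are left eigenvectors, nonzero because [U] is
     invertible. *)
  rewrite lD; apply/eigenvalueP; exists (row i U).
    rewrite {1}AcE -row_mul !mulmxA mulmxV// mul1mx row_mul.
    by rewrite row_diag_mx -scalemxAl -rowE.
  apply/eqP => /(congr1 (mulmx^~ (invmx U))).
  rewrite -row_mul mulmxV// mul0mx => /matrixP/(_ 0 i)/eqP.
  by rewrite !mxE eqxx oner_eq0.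
(* The embedding into [R[i]] is injective on matrices, and over [R[i]] a polynomial in [Ac] is
   conjugate to the diagonal of its values on the spectrum. *)
move=> p q pq; apply: (@map_mx_inj _ _ (real_complex R)).
have hornerAc r : horner_mx Ac (map_poly (real_complex R) r) =
    invmx U *m diag_mx (\row_i (r.[l i])%:C%C) *m U.
  rewrite AcE -{2}[U]invmxK horner_mx_uconj ?unitmx_inv// invmxK horner_mx_diag.
  congr (_ *m diag_mx _ *m _); apply/rowP => i.
  by rewrite !mxE -lD horner_map.
rewrite !map_horner_mx/= !hornerAc.
congr (_ *m diag_mx _ *m _); apply/rowP => i.
by rewrite !mxE pq// codom_f.
Qed.

Lemma trmx_horner_mx n (A : 'M[R]_n.+1) p :
  (horner_mx A p)^T = horner_mx A^T p.
Proof.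
elim/poly_ind: p => [|p c IH]; first by rewrite !rmorph0 trmx0.
rewrite !rmorphD !rmorphM /= !horner_mx_X !horner_mx_C linearD/=.
rewrite tr_scalar_mx trmx_mul IH; congr (_ + _).
exact: comm_mx_horner.
Qed.

Lemma posdef_unitmx d (A : 'M[R]_d) : posdef A -> A \in unitmx.
Proof.
move=> [_ pA]; rewrite -row_free_unit -kermx_eq0; apply/rowV0P => v.
move=> /sub_kermxP vA0; apply/eqP/negPn/negP => v0.
have := pA v^T; rewrite trmx_eq0 trmxK vA0 mul0mx mxE ltxx.
by move=> /(_ v0).
Qed.

(** For a left eigenvector [v], the quadratic form at [v^T] is [a] times the squared length of
    [v]. *)
Lemma posdef_eigenvalue_gt0 d (A : 'M[R]_d) a :
  posdef A -> eigenvalue A a -> 0 < a.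
Proof.
move=> [_ pA] /eigenvalueP[v vA v0].
have dot_ge0 : 0 <= (v *m v^T) 0 0.
  by rewrite mxE; apply: sumr_ge0 => i _; rewrite mxE -expr2 sqr_ge0.
have := pA v^T; rewrite trmx_eq0 trmxK vA => /(_ v0).
rewrite -scalemxAl mxE; apply: contraTT; rewrite -!leNgt => a_le0.
exact: mulr_le0_ge0.
Qed.

(** By symmetry of [C], the form of [C *m C] at [x] is the squared length of [C *m x], which is
    nonzero when [x] is. *)
Lemma posdef_sqr d (C : 'M[R]_d) : C^T = C -> C \in unitmx -> posdef (C *m C).
Proof.
move=> symC uC; split; first by rewrite trmx_mul symC.
move=> x x0; rewrite !mulmxA -{1}symC -trmx_mul -mulmxA.
rewrite mxE lt0r sumr_ge0; last by move=> i _; rewrite mxE -expr2 sqr_ge0.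
rewrite andbT psumr_eq0; last by move=> i _; rewrite mxE -expr2 sqr_ge0.
apply: contra x0 => /allP Cx0; rewrite -(mulKmx uC x).
suff -> : C *m x = 0 by rewrite mulmx0.
apply/colP => i; have := Cx0 i (mem_index_enum i).
by rewrite mxE -expr2 sqrf_eq0 => /eqP ->; rewrite mxE.
Qed.

(* Interpolating the fourth root on the spectrum gives a symmetric [C] with
   [C^4 = A], and [C * C] is positive definite for free. *)
Lemma posdef_sqrt_exists d (A : 'M[R]_d) :
  posdef A -> exists2 B : 'M[R]_d, posdef B & B *m B = A.
Proof.
(* Polynomials in a matrix live in the ring of matrices of nonzero size; in size 0 the empty matrix
   is its own root. *)
case: d A => [A [symA pA]|n A pA]; first by exists A; rewrite // [A]flatmx0 mul0mx.
have [symA _] := pA; have [s [sA hornerA]] := sym_spectrum symA.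
have [p ps] := poly_interpolation s (fun a => Num.sqrt (Num.sqrt a)).
pose C := horner_mx A p.
have symC : C^T = C by rewrite trmx_horner_mx symA.
have CE : (C *m C) *m (C *m C) = A.
  rewrite -[RHS]horner_mx_X -[LHS]/(C * C * (C * C)) -!rmorphM; apply: hornerA.
  move=> a sa; rewrite !hornerM hornerX ps// -!expr2.
  have a_gt0 : 0 < a by exact: posdef_eigenvalue_gt0 (sA _ sa).
  by rewrite !sqr_sqrtr// ?sqrtr_ge0// ltW.
exists (C *m C) => //; apply: posdef_sqr => //.
(* [C] is invertible because its fourth power [A] is. *)
by have := posdef_unitmx pA; rewrite -CE !unitmx_mul; case/andP => /andP[].
Qed.

(** Existence of a root makes [xget] return a member of its set instead of the default 0. *)
Lemma sqrtmxP d (A : 'M[R]_d) :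
  posdef A -> posdef (sqrtmx A) /\ sqrtmx A *m sqrtmx A = A.
Proof.
move=> /posdef_sqrt_exists[B pB BB].
apply: (@xgetPex _ 0 [set M : 'M[R]_d | posdef M /\ M *m M = A]).
by exists B.
Qed.

Lemma sqrtmx_unit d (A : 'M[R]_d) : posdef A -> sqrtmx A \in unitmx.
Proof. by move=> /sqrtmxP[/posdef_unitmx]. Qed.

(** Multiplying by the root of [S] on both sides undoes the conjugation. This turns a vanishing
    Frobenius term into equality of covariances. *)
Lemma invsqrtmx_conjE d (A S : 'M[R]_d) : posdef S ->
  (invsqrtmx S *m A *m invsqrtmx S == 1%:M) = (A == S).
Proof.
move=> pS; have uB := sqrtmx_unit pS; have [_ BB] := sqrtmxP pS.
rewrite /invsqrtmx; apply/eqP/eqP => [AE|->].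
  rewrite -[RHS]BB -[X in X *m _]mulmx1 -AE !mulmxA mulmxV// mul1mx.
  by rewrite -mulmxA mulVmx// mulmx1.
by rewrite -{2}BB !mulmxA mulVmx// mul1mx mulmxV.
Qed.

(** The form of [invmx A] at [x] is the form of [A] at [invmx A *m x]. *)
Lemma posdef_invmx d (A : 'M[R]_d) : posdef A -> posdef (invmx A).
Proof.
move=> pA; have uA := posdef_unitmx pA; have [symA pA0] := pA.
split; first by rewrite trmx_inv symA.
move=> x x0; have := pA0 (invmx A *m x).
rewrite trmx_mul trmx_inv symA -!mulmxA mulKVmx//; apply.
by apply: contra x0 => /eqP Ax0; rewrite -(mulKVmx uA x) Ax0 mulmx0.
Qed.

Lemma posdef_quad_ge0 d (A : 'M[R]_d) (x : 'cV_d) :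
  posdef A -> 0 <= (x^T *m A *m x) 0 0.
Proof.
move=> [_ pA]; have [->|/pA/ltW//] := eqVneq x 0.
by rewrite mulmx0 mxE.
Qed.

Lemma posdef_quad_eq0 d (A : 'M[R]_d) (x : 'cV_d) : posdef A ->
  ((x^T *m A *m x) 0 0 == 0) = (x == 0).
Proof.
move=> [_ pA]; have [->|/pA/gt_eqF//] := eqVneq x 0.
by rewrite mulmx0 mxE eqxx.
Qed.

(** * Vanishing of the norms, polarization, and the zeros of [gaussianD] *)

Lemma frob_norm_eq0 d (A : 'M[R]_d) : (frob_norm A == 0) = (A == 0).
Proof.
have sq_ge0 i : 0 <= \sum_j A i j ^+ 2 by apply: sumr_ge0 => j _; exact: sqr_ge0.
(* [Num.sqrt] also vanishes on negative reals, so nonnegativity of the sum is what turns [<= 0] into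
   [= 0]. *)
rewrite sqrtr_eq0 le_eqVlt ltNge sumr_ge0// orbF.
apply/eqP/eqP => [/(psumr_eq0P (fun i _ => sq_ge0 i)) A0|->]; last first.
  by rewrite big1// => i _; rewrite big1// => j _; rewrite mxE expr0n.
apply/matrixP => i j; rewrite mxE; apply/eqP; rewrite -sqrf_eq0.
have := psumr_eq0P (fun j _ => sqr_ge0 (A i j)) (A0 i isT).
by move=> ->.
Qed.

Lemma quad_norm_eq0 d (A : 'M[R]_d) (x : 'cV_d) : posdef A ->
  (quad_norm A x == 0) = (x == 0).
Proof.
move=> pA; rewrite sqrtr_eq0 le_eqVlt ltNge posdef_quad_ge0// orbF.
exact: posdef_quad_eq0.
Qed.

Lemma quad_normN d (A : 'M[R]_d) (x : 'cV_d) : quad_norm A (- x) = quad_norm A x.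
Proof. by rewrite /quad_norm [(- x)^T]linearN/= !mulNmx mulmxN opprK. Qed.

(** Polarization: the form at two basis vectors and at their sum determines twice the corresponding
    entry of a symmetric matrix. *)
Lemma eq_sym_quad d (A B : 'M[R]_d) : A^T = A -> B^T = B ->
  (forall x : 'cV[R]_d, (x^T *m A *m x) 0 0 = (x^T *m B *m x) 0 0) -> A = B.
Proof.
move=> symA symB AB; apply/matrixP => i j.
have bilE (M : 'M[R]_d) k l :
    ((delta_mx k 0 : 'cV[R]_d)^T *m M *m (delta_mx l 0 : 'cV[R]_d)) 0 0 = M k l.
  by rewrite trmx_delta -rowE -colE !mxE.
have polar (M : 'M[R]_d) : M^T = M -> forall x y : 'cV[R]_d,
    ((x + y)^T *m M *m (x + y)) 0 0 =
    (x^T *m M *m x) 0 0 + (y^T *m M *m y) 0 0 + (x^T *m M *m y) 0 0 *+ 2.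
  move=> symM x y; rewrite [(x + y)^T]linearD/= !mulmxDl !mulmxDr.
  have -> : y^T *m M *m x = (x^T *m M *m y)^T.
    by rewrite !trmx_mul trmxK symM mulmxA.
  by rewrite !mxE; ring.
have := AB (delta_mx i 0 + delta_mx j 0); rewrite !polar// !AB !bilE.
by move/addrI/eqP; rewrite eqrMn2r /= => /eqP.
Qed.

Lemma gaussianD_sym d muP muQ (SP SQ : 'M[R]_d) :
  gaussianD muP SP muQ SQ = gaussianD muQ SQ muP SP.
Proof.
rewrite /gaussianD -(opprB muQ muP) !quad_normN.
by rewrite -!addrA addrCA; congr (_ + (_ + _)); rewrite addrC.
Qed.

Lemma gaussianD_eq0 d muP muQ (SP SQ : 'M[R]_d) : posdef SP -> posdef SQ ->
  gaussianD muP SP muQ SQ = 0 <-> muP = muQ /\ SP = SQ.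
Proof.
move=> pP pQ; have s2 : 0 < 1 / Num.sqrt 2 :> R by rewrite divr_gt0// sqrtr_gt0.
have frob_ge0 (M : 'M[R]_d) : 0 <= 1 / 2 * frob_norm M.
  by rewrite mulr_ge0// sqrtr_ge0.
have quad_ge0 (M : 'M[R]_d) x : 0 <= 1 / Num.sqrt 2 * quad_norm M x.
  by rewrite mulr_ge0// ?sqrtr_ge0// ltW.
have h2 : 0 < 1 / 2 :> R by rewrite divr_gt0.
have frobE (M : 'M[R]_d) : (1 / 2 * frob_norm M == 0) = (M == 0).
  by rewrite mulf_eq0 (gt_eqF h2) frob_norm_eq0.
have quadE (M : 'M[R]_d) (x : 'cV_d) : posdef M ->
    (1 / Num.sqrt 2 * quad_norm (invmx M) x == 0) = (x == 0).
  move=> pM; rewrite mulf_eq0 (gt_eqF s2) quad_norm_eq0//.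
  exact: posdef_invmx.
rewrite /gaussianD; split=> [/eqP|[-> ->]].
  rewrite !paddr_eq0 ?addr_ge0// !frobE !quadE// !subr_eq0 !invsqrtmx_conjE//.
  by case/andP => /andP[/andP[/eqP -> _] /eqP ->].
apply/eqP; rewrite !paddr_eq0 ?addr_ge0// !frobE !quadE// !subr_eq0.
by rewrite !invsqrtmx_conjE// !eqxx.
Qed.

End matrix_sqrt.

(** * Lebesgue measure of boxes and comparison of continuous densities *)

Section boxes.
Context {R : realType}.

(** For [0 < e] this is the sup-norm ball of column vectors, moved to tuples, where the measure
    lives. *)
Definition box d (c : 'I_d -> R) (e : R) : set (Rvec R d) :=
  [set t | forall i, ball (c i) e (tnth t i)].

Lemma measurable_box d (c : 'I_d -> R) e : measurable (box c e).
Proof.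
rewrite (_ : box c e = \bigcap_i ((tnth (T := R))^~ i @^-1` ball (c i) e)).
  apply: fin_bigcap_measurable => // i _.
  rewrite -[X in measurable X]setTI; apply: measurable_tnth => //.
  exact: measurable_ball.
by apply/seteqP; split => [t bt i _|t bt i]; exact: bt.
Qed.

(** By induction on [d]: a box is the product of an interval of length [e *+ 2] and a box of one
    dimension less, starting from the unit mass in dimension 0. *)
Lemma lebesgue_tuple_box_gt0 d (c : 'I_d -> R) e :
  0 < e -> (0 < lebesgue_tuple d (box c e))%E.
Proof.
move=> e0; elim: d c => [|n IH] c.
  by rewrite /= diracE mem_set ?lte01// => -[].
rewrite [X in (0 < X)%E](_ : _ = (lebesgue_measure \x lebesgue_tuple n)%E
    (ball (c ord0) e `*` box (c \o lift ord0) e)).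
  rewrite product_measure1E; [|exact: measurable_ball|exact: measurable_box].
  apply: mule_gt0; last exact: IH.
  rewrite [X in (0 < X)%E](_ : _ = (e *+ 2)%:E) ?lte_fin ?mulrn_wgt0//.
  exact: lebesgue_measure_ball (ltW e0).
rewrite /= /lebesgue_cons /pushforward; congr (_ _).
apply/seteqP; split => [[x t] /= b|[x t] /= [bx bt]].
  split; first exact: (b ord0).
  by move=> i; have := b (lift ord0 i); rewrite tnthS.
move=> i; case: (unliftP ord0 i) => [j|] ->; last exact: bx.
by rewrite tnthS; exact: bt.
Qed.

(** If [g y < f y], continuity gives a box [B] around [y] and [r > 0] with [g + r <= f] on [B].
    Integrating over [B] bounds [P B] below by itself plus [r] times the positive volume of [B],
    which is absurd as [P B] is finite. *)
Lemma le_continuous_density d (f g : 'cV[R]_d -> R)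
    (P : probability (Rvec R d) R) :
  continuous f -> continuous g ->
  measurable_fun [set: Rvec R d] (fun t => f (\col_i tnth t i)) ->
  measurable_fun [set: Rvec R d] (fun t => g (\col_i tnth t i)) ->
  (forall y, 0 <= g y) ->
  (forall A, measurable A ->
     P A = (\int[lebesgue_tuple d]_(t in A) (f (\col_i tnth t i))%:E)%E) ->
  (forall A, measurable A ->
     P A = (\int[lebesgue_tuple d]_(t in A) (g (\col_i tnth t i))%:E)%E) ->
  forall y, f y <= g y.
Proof.
move=> cf cg mf mg g0 Pf Pg y; rewrite leNgt; apply/negP => fgy.
pose r := (f y - g y) / 2; have r0 : 0 < r by rewrite divr_gt0// subr_gt0.
have : nbhs y [set z | r < (f - g) z].
  have : {for y, continuous (f - g)} by apply: continuousB; [exact: cf|exact: cg].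
  move=> /(cvgr_gt _); apply; rewrite /r -[(f - g) y]/(f y - g y).
  by rewrite ltr_pdivrMr// ltr_pMr ?subr_gt0// ltr1n.
move=> /nbhs_ballP[e /= e0 eP].
pose B := box (fun i => y i 0) e.
have mB : measurable B by exact: measurable_box.
have gf t : B t -> g (\col_i tnth t i) + r <= f (\col_i tnth t i).
  move=> Bt; rewrite addrC -lerBrDr; apply/ltW/(eP (\col_i tnth t i)).
  by split => // i j; rewrite ord1 mxE; exact: Bt.
have PB_fin : P B \is a fin_num by exact: fin_num_measure.
have : (P B + r%:E * lebesgue_tuple d B <= P B)%E.
  rewrite {1}(Pg _ mB) (Pf _ mB) -integral_cst// -ge0_integralD//=.
  - apply: ge0_le_integral => //=.
    + by move=> t _; rewrite -EFinD lee_fin addr_ge0// ltW.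
    + by apply/measurable_EFinP/measurable_funD => //; apply: measurable_funTS.
    + by apply/measurable_EFinP; apply: measurable_funTS.
  - by move=> t _; rewrite lee_fin.
  - by apply/measurable_EFinP; apply: measurable_funTS.
  - by move=> t _; rewrite lee_fin ltW.
rewrite leNgt lteDl// mule_gt0//.
exact: lebesgue_tuple_box_gt0.
Qed.

End boxes.

(** * Gaussian densities and recovery of the mean and covariance from the law *)

Section gaussian_parameters.
Context {R : realType}.

(** Reduces continuity and measurability of the form to those of the coordinates. *)
Lemma quad_formE d (M : 'M[R]_d) (y : 'cV[R]_d) :
  (y^T *m M *m y) 0 0 = \sum_j \sum_i y i 0 * M i j * y j 0.
Proof.
rewrite mxE; apply: eq_bigr => j _; rewrite mxE mulr_suml.
by apply: eq_bigr => i _; rewrite mxE.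
Qed.

(** The formula of [gaussian_pdf] on column vectors, whose topology makes continuity meaningful; at
    [\col_i tnth t i] it unfolds to [gaussian_pdf mu S t]. *)
Definition gaussian_density d (mu : 'cV[R]_d) (S : 'M[R]_d) (y : 'cV[R]_d) : R :=
  expR (- (1 / 2) * ((y - mu)^T *m invmx S *m (y - mu)) 0 0)
  / Num.sqrt ((2 * pi) ^+ d * \det S).

Lemma gaussian_density_ge0 d (mu : 'cV[R]_d) S y : 0 <= gaussian_density mu S y.
Proof. by rewrite divr_ge0// ?expR_ge0// sqrtr_ge0. Qed.

Lemma continuous_gaussian_density d (mu : 'cV[R]_d) S :
  continuous (gaussian_density mu S).
Proof.
have cM (u v : 'cV[R]_d -> R) : continuous u -> continuous v ->
    continuous (fun y => u y * v y).
  by move=> cu cv y; exact: (continuousM (cu y) (cv y)).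
have ccst (c : R) : continuous (fun _ : 'cV[R]_d => c).
  by move=> y; exact: cst_continuous.
apply: (cM) => //.
pose u (y : 'cV[R]_d) := - (1 / 2) * ((y - mu)^T *m invmx S *m (y - mu)) 0 0.
suff cu : continuous u.
  by move=> y; exact: (continuous_comp (cu y) (@continuous_expR R _)).
apply: (cM) => //; under eq_fun do rewrite quad_formE.
apply: continuous_big => [|j _]; first exact: add_continuous.
apply: continuous_big => [|i _]; first exact: add_continuous.
have cB k : continuous (fun y : 'cV[R]_d => (y - mu) k 0).
  under eq_fun do rewrite !mxE.
  by move=> y; exact: (continuousB (@coord_continuous _ _ _ k 0 y) (ccst _ y)).
by do 2 apply: (cM) => //.
Qed.

Lemma measurable_gaussian_density d (mu : 'cV[R]_d) S :
  measurable_fun [set: Rvec R d]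
    (fun t => gaussian_density mu S (\col_i tnth t i)).
Proof.
apply: measurable_funM => //; apply: measurableT_comp => //.
apply: measurable_funM => //.
under eq_fun do rewrite quad_formE.
apply: measurable_sum => j; apply: measurable_sum => i.
have mB k : measurable_fun [set: Rvec R d]
    (fun t => (\col_l tnth t l - mu) k 0).
  under eq_fun do rewrite !mxE.
  by apply: measurable_funB => //; exact: measurable_tnth.
by do 2 (apply: measurable_funM => //).
Qed.

(* Since [x / 0 = 0], a vanishing normalising constant would make the total mass
   [0]; no computation of the Gaussian integral is needed. *)
Lemma gaussian_norm_neq0 d (mu : 'cV[R]_d) S (P : probability (Rvec R d) R) :
  is_gaussian mu S P -> Num.sqrt ((2 * pi) ^+ d * \det S) != 0.
Proof.
move=> gP; apply/eqP => c0; have := gP setT measurableT.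
rewrite probability_setT /gaussian_pdf c0.
under eq_integral do rewrite invr0 mulr0.
by rewrite integral0 => /eqP; rewrite onee_eq0.
Qed.

(** Two continuous densities of the same law bound each other, by [le_continuous_density] applied in
    both directions. *)
Lemma gaussian_density_unique d (mu1 mu2 : 'cV[R]_d) S1 S2
    (P : probability (Rvec R d) R) :
  is_gaussian mu1 S1 P -> is_gaussian mu2 S2 P ->
  gaussian_density mu1 S1 = gaussian_density mu2 S2.
Proof.
have le_density mu S mu' S' : is_gaussian mu S P -> is_gaussian mu' S' P ->
    forall y : 'cV[R]_d, gaussian_density mu S y <= gaussian_density mu' S' y.
  move=> gS gS'; apply: (le_continuous_density _ _ _ _ _ gS gS').
  - exact: continuous_gaussian_density.
  - exact: continuous_gaussian_density.
  - exact: measurable_gaussian_density.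
  - exact: measurable_gaussian_density.
  - exact: gaussian_density_ge0.
by move=> g1 g2; apply/funext => y; apply/le_anti; rewrite !le_density.
Qed.

Lemma gaussian_parameters_unique d (mu1 mu2 : 'cV[R]_d) S1 S2
    (P : probability (Rvec R d) R) :
  posdef S1 -> posdef S2 -> is_gaussian mu1 S1 P -> is_gaussian mu2 S2 P ->
  mu1 = mu2 /\ S1 = S2.
Proof.
move=> p1 p2 g1 g2; have dE := gaussian_density_unique g1 g2.
have [pi1 pi2] := (posdef_invmx p1, posdef_invmx p2).
pose q (mu : 'cV[R]_d) (S : 'M[R]_d) (y : 'cV[R]_d) : R :=
  ((y - mu)^T *m invmx S *m (y - mu)) 0 0.
have c_gt0 mu S : is_gaussian mu S P ->
    0 < (Num.sqrt ((2 * pi) ^+ d * \det S))^-1.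
  by move=> /gaussian_norm_neq0 c0; rewrite invr_gt0 lt0r c0 sqrtr_ge0.
have [k qE] : exists k, forall y, q mu1 S1 y = q mu2 S2 y + k.
  have [a0 b0] := (c_gt0 _ _ g1, c_gt0 _ _ g2).
  set a := (X in 0 < X) in a0; set b := (X in 0 < X) in b0.
  (* Taking logarithms of the equal densities: [a] and [b] are the positive normalising factors, and
     the 2 cancels the 1/2 in the exponents. *)
  exists (2 * (ln a - ln b)) => y.
  have : expR (- (1 / 2) * q mu1 S1 y) * a = expR (- (1 / 2) * q mu2 S2 y) * b.
    exact: (congr1 (@^~ y) dE).
  move=> /(congr1 (@ln R)); rewrite !lnM ?posrE ?expR_gt0// !expRK.
  lra.
(* Evaluating at [mu1] and [mu2] gives [k <= 0] and [k >= 0]. *)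
have q0 mu S : q mu S mu = 0 by rewrite /q subrr mulmx0 mxE.
have q_ge0 : 0 <= q mu1 S1 mu2 by exact: posdef_quad_ge0.
have : q mu2 S2 mu1 == 0.
  have := qE mu1; rewrite q0 => k1; have := qE mu2; rewrite q0 add0r => k2.
  have : 0 <= q mu2 S2 mu1 by exact: posdef_quad_ge0.
  by rewrite le_eqVlt => /orP[/eqP <- //|]; lra.
rewrite posdef_quad_eq0// subr_eq0 => /eqP mu12.
have k0 : k = 0 by have := qE mu1; rewrite mu12 !q0 add0r.
split=> //; rewrite -[S1]invmxK -[S2]invmxK; congr invmx.
apply: eq_sym_quad; [exact: pi1.1|exact: pi2.1|move=> x].
(* With a common mean and [k = 0], shifting by the mean makes both forms centred at the origin. *)
by have := qE (x + mu1); rewrite k0 addr0 /q mu12 addrK.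
Qed.

End gaussian_parameters.

Theorem lemma3p1 (R : realType) (d : nat)
    (muP muQ : 'cV[R]_d) (SP SQ : 'M[R]_d)
    (P Q : probability (Rvec R d) R) :
  posdef SP -> posdef SQ ->
  is_gaussian muP SP P -> is_gaussian muQ SQ Q ->
  gaussianD muP SP muQ SQ = gaussianD muQ SQ muP SP
  /\ (gaussianD muP SP muQ SQ = 0 <-> measure_eq P Q)
  /\ gaussianD muP SP muP SP = 0.
Proof.
move=> pP pQ gP gQ; split; first exact: gaussianD_sym.
split; last exact/gaussianD_eq0.
split=> [/(gaussianD_eq0 _ _ pP pQ)[muE SE] A mA|PQ].
  by rewrite [LHS]gP// [RHS]gQ// muE SE.
(* Equality of the laws makes [P] Gaussian with the parameters of [Q] as well, so uniqueness applies
   to the single measure [P]. *)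
apply/gaussianD_eq0 => //; apply: gaussian_parameters_unique gP _ => // A mA.
exact: etrans (PQ A mA) (gQ A mA).
Qed.
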